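(* Let $S$ be a $\mathrm{Cu}$-semigroup, and let $n\in\mathbb{N}$. Then the following are equivalent: (1) $\dim(S)\leq n$; (2) every countable subset of $S$ is contained in a countably based sub-$\mathrm{Cu}$-semigroup $T\subseteq S$ satisfying $\dim(T)\leq n$; (3) every finite subset of $S$ is contained in a sub-$\mathrm{Cu}$-semigroup $T\subseteq S$ satisfying $\dim(T)\leq n$.
   Context: Way-below relation: in a partially ordered set, $x\ll y$ means that for every increasing sequence $(z_n)_n$ that has a supremum $z$ with $y\leq z$ there exists $n$ with $x\leq z_n$. A $\mathrm{Cu}$-semigroup is an abelian monoid $S$ with a partial order such that $0\leq x$ for all $x$, and $x\leq y$ implies $x+z\leq y+z$, satisfying: (O1) every increasing sequence has a supremum; (O2) every element is the supremum of a $\ll$-increasing sequence (i.e. $x_n\ll x_{n+1}$ for all $n$); (O3) $x'\ll x$ and $y'\ll y$ imply $x'+y'\ll x+y$; (O4) $\sup_n x_n+\sup_n y_n=\sup_n(x_n+y_n)$ for increasing sequences $(x_n)_n,(y_n)_n$. A $\mathrm{Cu}$-morphism is an order-preserving monoid morphism between $\mathrm{Cu}$-semigroups that preserves suprema of increasing sequences and the way-below relation. A submonoid $T\subseteq S$ is a sub-$\mathrm{Cu}$-semigroup if $T$ is a $\mathrm{Cu}$-semigroup with respect to the order induced by $S$ and the inclusion map $T\to S$ is a $\mathrm{Cu}$-morphism. A subset $B\subseteq S$ is a basis if for all $x',x\in S$ with $x'\ll x$ there exists $y\in B$ with $x'\ll y\ll x$; $S$ is countably based if it has a countable basis. Dimension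 (with $\mathbb{N}=\{0,1,2,\ldots\}$): for a $\mathrm{Cu}$-semigroup $S$ and $n\in\mathbb{N}$, write $\dim(S)\leq n$ if, whenever $x'\ll x\ll y_1+\ldots+y_r$ in $S$, there exist $z_{j,k}\in S$ for $j=1,\ldots,r$ and $k=0,\ldots,n$ such that (i) $z_{j,k}\ll y_j$ for all $j,k$; (ii) $x'\ll\sum_{j,k}z_{j,k}$; (iii) $\sum_{j=1}^r z_{j,k}\ll x$ for each $k=0,\ldots,n$. Then $\dim(S)$ is the smallest such $n$, and $\dim(S)=\infty$ if no such $n$ exists. *)

(* Defs.v *)
From HB Require Import structures.
From mathcomp Require Import all_boot all_order.
From mathcomp Require Import classical_sets cardinality.

Set Implicit Arguments.
Unset Strict Implicit.
Unset Printing Implicit Defensive.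

Import Order.TTheory.
Local Open Scope classical_set_scope.
Local Open Scope ring_scope.

(* "Increasing" is always meant in the weak sense, z n <= z n.+1. *)
Definition way_below (d : Order.disp_t) (S : porderType d) (x y : S) : Prop :=
  forall z : nat -> S, Order.nondecreasing z ->
  forall s : S, supremums (range z) s -> (y <= s)%O ->
  exists n, (x <= z n)%O.

Notation "x ≪ y" := (way_below x y) (at level 70, no associativity).

#[short(type="porderNmodType")]
HB.structure Definition POrderedNmodule (d : Order.disp_t) :=
  { S of Order.POrder d S & Algebra.Nmodule S }.

HB.mixin Record isPositivelyOrdered (d : Order.disp_t) S
    of POrderedNmodule d S := {
  pomon_ge0 : forall x : S, (0 <= x)%O;
  pomon_leD2r : forall x y z : S, (x <= y)%O -> (x + z <= y + z)%O
}.

#[short(type="poMonoidType")]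
HB.structure Definition POMonoid (d : Order.disp_t) :=
  { S of isPositivelyOrdered d S & POrderedNmodule d S }.

Record Cu_semigroup (d : Order.disp_t) (S : poMonoidType d) : Prop :=
    CuSemigroup {
  Cu_O1 : forall x : nat -> S, Order.nondecreasing x ->
    exists s, supremums (range x) s;
  Cu_O2 : forall s : S, exists x : nat -> S,
    (forall n, x n ≪ x n.+1) /\ supremums (range x) s;
  Cu_O3 : forall x' x y' y : S, x' ≪ x -> y' ≪ y -> x' + y' ≪ x + y;
  Cu_O4 : forall x y : nat -> S,
    Order.nondecreasing x -> Order.nondecreasing y ->
    forall s t : S, supremums (range x) s -> supremums (range y) t ->
    supremums (range (fun n => x n + y n)) (s + t)
}.

Record Cu_morphism (d d' : Order.disp_t) (S : poMonoidType d)
    (T : poMonoidType d') (f : S -> T) : Prop := CuMorphism {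
  Cu_morphD : Algebra.nmod_morphism f;
  Cu_morph_le : Order.nondecreasing f;
  Cu_morph_sup : forall x : nat -> S, Order.nondecreasing x ->
    forall s, supremums (range x) s -> supremums (range (f \o x)) (f s);
  Cu_morph_wb : forall x y : S, x ≪ y -> f x ≪ f y
}.

Section Submonoid.
Variables (d : Order.disp_t) (S : poMonoidType d) (T : addrClosed S).

Definition submonoid : Type := {x : S | x \in T}.

HB.instance Definition _ := SubChoice.on submonoid.

Fact submonoid_closed : Algebra.nmod_closed [in T].
Proof. exact: Algebra.rpred0D. Qed.

HB.instance Definition _ :=
  Algebra.SubChoice_isSubNmodule.Build S _ submonoid submonoid_closed.
HB.instance Definition _ :=
  [SubChoice_isSubPOrder of submonoid by <: with d].

Fact submonoid_ge0 (x : submonoid) : (0 <= x)%O.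
Proof. by rewrite -Order.le_val Algebra.raddf0 pomon_ge0. Qed.

Fact submonoid_leD2r (x y z : submonoid) :
  (x <= y)%O -> (x + z <= y + z)%O.
Proof. by rewrite -!Order.le_val !Algebra.raddfD; exact: pomon_leD2r. Qed.

HB.instance Definition _ :=
  isPositivelyOrdered.Build d submonoid submonoid_ge0 submonoid_leD2r.

End Submonoid.

(* In the first conjunct, suprema and ≪ are computed inside T. *)
Definition sub_Cu_semigroup (d : Order.disp_t) (S : poMonoidType d)
    (T : addrClosed S) : Prop :=
  Cu_semigroup (submonoid T) /\ Cu_morphism (val : submonoid T -> S).

Definition Cu_basis (d : Order.disp_t) (S : poMonoidType d)
    (B : set S) : Prop :=
  forall x' x : S, x' ≪ x -> exists y, [/\ B y, x' ≪ y & y ≪ x].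

Definition countably_based (d : Order.disp_t) (S : poMonoidType d) : Prop :=
  exists B : set S, countable B /\ Cu_basis B.

Definition dim_le (d : Order.disp_t) (S : poMonoidType d) (n : nat) : Prop :=
  forall (r : nat) (x' x : S) (y : 'I_r -> S),
    x' ≪ x -> x ≪ \sum_(j < r) y j ->
  exists z : 'I_r -> 'I_n.+1 -> S,
    [/\ forall j k, z j k ≪ y j,
        x' ≪ \sum_(j < r) \sum_(k < n.+1) z j k
      & forall k, \sum_(j < r) z j k ≪ x].

(* Main.v *)
Require Import Defs.
From HB Require Import structures.
From mathcomp Require Import all_boot all_order.
From mathcomp Require Import boolp classical_sets cardinality.

(** Everything happens around a submonoid [D] of [S] in which every
    relation [u ≪ x] with [x] in [D] can be interpolated by an element of [D]. Call [s] interpolated by [D] if every [u ≪ s] admits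
    [e] in [D] with [u ≪ e ≪ s]. The interpolated elements form a submonoid
    that is closed under suprema of increasing sequences, and each of them is
    the supremum of a ≪-increasing sequence in [D]; hence they form a
    sub-Cu-semigroup [T] containing [D], the relation ≪ of [T] is that
    of [S], and [D] is a basis of [T] ([interpolated_sub_Cu],
    [sub_Cu_of_closed]).

    The same interpolation reduces the condition [dim(T) <= n] to elements of
    [D]. If [x' ≪ x ≪ y_1 + ... + y_r] in [T], the [y_j] can be shrunk to [v_j]
    in [D] whose sum still lies way above [x], and [x', x] can be replaced by
    [a' ≪ a] in [D] with [x' ≪ a' ≪ a ≪ x]; a solution for [a', a, v_j] is a
    solution for the given data. So it suffices that [D] contains solutions for
    all data taken from [D] ([dim_le_sub]).

    If [dim(S) <= n], all these requirements on [D] say that finite tuples of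
    [D] have countably many witnesses in [D]. By a Löwenheim-Skolem argument any
    countable set can be enlarged to a countable [D] of this kind
    ([countable_closure], [countable_elementary_subset]), which yields
    countably based sub-Cu-semigroups of dimension at most [n] containing any
    given countable set. Conversely, an instance of the dimension condition
    of [S] involves only finitely many elements; it can be solved in a
    sub-Cu-semigroup of dimension at most [n] containing them, because
    the inclusion preserves and reflects ≪ ([sub_Cu_way_belowE], [dim_le_of_sub]). *)

Local Open Scope classical_set_scope.

Set Implicit Arguments.
Unset Strict Implicit.
Unset Printing Implicit Defensive.
Import Order.TTheory.
Local Open Scope ring_scope.

(** * The way-below relation *)

Section WayBelow.
Context {d : Order.disp_t} {S : poMonoidType d}.
Implicit Types x y z s t u : S.

Lemma sup_ub (z : nat -> S) s n : supremums (range z) s -> (z n <= s)%O.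
Proof. by move=> [ub _]; apply: ub; exists n. Qed.

Lemma sup_unique (z : nat -> S) s t :
  supremums (range z) s -> supremums (range z) t -> s = t.
Proof.
by move=> [us ls] [ut lt]; apply/eqP; rewrite eq_le ls ?lt.
Qed.

Lemma nondecreasing_step (z : nat -> S) :
  (forall n, (z n <= z n.+1)%O) -> Order.nondecreasing z.
Proof.
move=> zS m n; rewrite leEnat.
exact: (homo_leq (r := <=%O) lexx le_trans zS).
Qed.

Lemma way_below_le x y : x ≪ y -> (x <= y)%O.
Proof.
move=> xy; have [//||n] := xy (fun=> y) _ y _ (lexx y); last by [].
by split=> [_ [_ _ <-]//|u]; apply; exists 0.
Qed.

Lemma le_way_below x y z : (x <= y)%O -> y ≪ z -> x ≪ z.
Proof.
move=> xy yz w wnd s ws zs; have [n yn] := yz w wnd s ws zs.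
by exists n; exact: le_trans yn.
Qed.

Lemma way_below_trans_le x y z : x ≪ y -> (y <= z)%O -> x ≪ z.
Proof.
by move=> xy yz w wnd s ws zs; apply: xy ws _ => //; exact: le_trans zs.
Qed.

Lemma way_below_trans x y z : x ≪ y -> y ≪ z -> x ≪ z.
Proof. by move=> /way_below_le; exact: le_way_below. Qed.

Lemma way_below0 x : (0 : S) ≪ x.
Proof. by move=> z _ s _ _; exists 0; exact: pomon_ge0. Qed.

Lemma pomon_leD (x y z t : S) : (x <= y)%O -> (z <= t)%O -> (x + z <= y + t)%O.
Proof.
move=> xy zt; apply: le_trans (pomon_leD2r _ _ _ xy) _.
by rewrite ![y + _]Algebra.addrC; exact: pomon_leD2r.
Qed.

Lemma way_below_chain (z : nat -> S) :
  (forall n, z n ≪ z n.+1) -> Order.nondecreasing z.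
Proof. by move=> zS; apply: nondecreasing_step => n; exact: way_below_le. Qed.

Lemma chain_way_below (z : nat -> S) s n :
  (forall n, z n ≪ z n.+1) -> supremums (range z) s -> z n ≪ s.
Proof. by move=> zS zs; exact: way_below_trans_le (zS n) (sup_ub _ zs). Qed.

Hypothesis hS : Cu_semigroup S.

Lemma way_below_interpolation x y :
  x ≪ y -> exists z, x ≪ z /\ z ≪ y.
Proof.
move=> xy; have [z [zS zy]] := Cu_O2 hS y.
have [n xn] := xy z (way_below_chain zS) y zy (lexx y).
exists (z n.+1); split; last exact: chain_way_below zy.
exact: le_way_below xn (zS n).
Qed.

Lemma way_below_sum (r : nat) (x y : 'I_r -> S) :
  (forall j, x j ≪ y j) -> \sum_(j < r) x j ≪ \sum_(j < r) y j.
Proof.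
move=> xy; apply: (big_ind2 (@way_below d S)) => [|x1 x2 y1 y2|j _].
- exact: way_below0.
- exact: Cu_O3.
- exact: xy.
Qed.

(** By [Cu_O4] and [Cu_O2], [s + t] is the supremum of the sums of two sequences
    lying way below [s] and [t]. *)
Lemma way_below_split x s t : x ≪ s + t ->
  exists s' t', [/\ s' ≪ s, t' ≪ t & x ≪ s' + t'].
Proof.
move=> /way_below_interpolation [w [xw wst]].
have [a [aS sa]] := Cu_O2 hS s; have [b [bS tb]] := Cu_O2 hS t.
have and_ := way_below_chain aS; have bnd := way_below_chain bS.
have [|n wn] := wst _ _ _ (Cu_O4 hS and_ bnd sa tb) (lexx _).
  by move=> i j ij; apply: pomon_leD; [exact: and_|exact: bnd].
exists (a n), (b n); split; [exact: chain_way_below|exact: chain_way_below|].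
exact: way_below_trans_le wn.
Qed.

Lemma way_below_split_sum x (r : nat) (y : 'I_r -> S) : x ≪ \sum_(j < r) y j ->
  exists y' : 'I_r -> S, (forall j, y' j ≪ y j) /\ x ≪ \sum_(j < r) y' j.
Proof.
elim: r => [|r IHr] in x y *.
  by rewrite big_ord0 => x0; exists y; split=> [[]//|]; rewrite big_ord0.
rewrite big_ord_recl => /way_below_split[a [b [ay /IHr[c [cy bc]] xab]]].
exists (fun j => oapp c a (unlift ord0 j)); split=> [j|].
  by case: (unliftP ord0 j) => [i|] -> /=.
rewrite big_ord_recl unlift_none /=.
apply: way_below_trans_le xab _; apply: pomon_leD => //.
rewrite (eq_bigr c) => [|i _]; first exact: way_below_le.
by rewrite liftK.
Qed.

End WayBelow.

(** * Elements interpolated by a subset *)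

Section Approximation.
Context {d : Order.disp_t} {S : poMonoidType d}.
Hypothesis hS : Cu_semigroup S.
Implicit Types (x y z s t u : S) (D : set S).

Definition interpolated D s : Prop :=
  forall u, u ≪ s -> exists e, [/\ D e, u ≪ e & e ≪ s].

(** Starting from a ≪-increasing sequence [x] with supremum [s], the terms are
    picked one after the other: the next one lies way above the previous one
    and above the corresponding [x n], which is possible because both are
    dominated by a single later term of [x]. *)
Lemma interpolated_chain D s : interpolated D s ->
  exists e : nat -> S,
    [/\ forall n, D (e n), forall n, e n ≪ e n.+1 & supremums (range e) s].
Proof.
move=> Ds; have [x [xS xs]] := Cu_O2 hS s.
(* The pair is an index of [x] and the last term picked. *)
have step (p : nat * S) : exists e, p.2 ≪ s ->
    [/\ D e, p.2 ≪ e, x p.1 ≪ e & e ≪ s].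
  have [ps|nps] := pselect (p.2 ≪ s); last by exists 0.
  have [m pm] := ps x (way_below_chain xS) s xs (lexx s).
  have [e [De me es]] := Ds _ (chain_way_below (maxn p.1 m) xS xs).
  exists e => _; split=> //.
    apply: le_way_below me; apply: le_trans pm _.
    by apply: (way_below_chain xS); rewrite leEnat leq_maxr.
  apply: le_way_below me.
  by apply: (way_below_chain xS); rewrite leEnat leq_maxl.
have [f fP] := choice step.
pose prev := fix prev n : S := if n is m.+1 then f (m, prev m) else 0.
pose g n := prev n.+1.
have prevs n : prev n ≪ s.
  elim: n => [|n IHn]; first exact: way_below0.
  by have [] := fP (n, prev n) IHn.
have gP n : [/\ D (g n), x n ≪ g n & g n ≪ g n.+1].
  have [Dg _ xg gs] := fP (n, prev n) (prevs n); split=> //.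
  by have [] := fP (n.+1, g n) (prevs n.+1).
exists g; split=> [n|n|]; [by case: (gP n)|by case: (gP n)|split].
  by move=> _ [n _ <-]; exact: way_below_le (prevs n.+1).
move=> u gu; apply: xs.2 => _ [n _ <-].
apply: le_trans (gu (g n) _); last by exists n.
by have [_ /way_below_le] := gP n.
Qed.

Lemma interpolated0 D : D 0 -> interpolated D 0.
Proof. by move=> D0 u u0; exists 0; split=> //; exact: way_below0. Qed.

Lemma interpolatedD D s t : (forall a b, D a -> D b -> D (a + b)) ->
  interpolated D s -> interpolated D t -> interpolated D (s + t).
Proof.
move=> DD Ds Dt u /(way_below_split hS)[a [b [as_ bt uab]]].
have [a' [Da aa' a's]] := Ds a as_; have [b' [Db bb' b't]] := Dt b bt.
exists (a' + b'); split; [exact: DD| |exact: Cu_O3].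
by apply: way_below_trans uab _; exact: Cu_O3.
Qed.

(** A relation [u ≪ s] factors through some [z n], so it can be interpolated
    there. *)
Lemma interpolated_sup D (z : nat -> S) s : Order.nondecreasing z ->
  (forall n, interpolated D (z n)) -> supremums (range z) s ->
  interpolated D s.
Proof.
move=> znd Dz zs u /(way_below_interpolation hS)[w [uw ws]].
have [n wn] := ws z znd s zs (lexx s).
have [e [De ue ez]] := Dz n u (way_below_trans_le uw wn).
by exists e; split=> //; exact: way_below_trans_le ez (sup_ub _ zs).
Qed.

End Approximation.

(** * Sub-Cu-semigroups *)

Section SubCu.
Context {d : Order.disp_t} {S : poMonoidType d}.
Hypothesis hS : Cu_semigroup S.

Variable T : addrClosed S.
Hypothesis Tsup : forall z : nat -> S, Order.nondecreasing z ->
  (forall n, z n \in T) -> forall s, supremums (range z) s -> s \in T.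
Hypothesis Tchain : forall s, s \in T -> exists z : nat -> S,
  [/\ forall n, z n \in T, forall n, z n ≪ z n.+1 & supremums (range z) s].

Lemma sup_val_sub (z : nat -> submonoid T) s :
  supremums (range (val \o z)) (val s) -> supremums (range z) s.
Proof.
move=> [us ls]; split=> [_ [n _ <-]|t zt].
  by rewrite -Order.le_val; apply: us; exists n.
rewrite -Order.le_val; apply: ls => _ [n _ <-].
by rewrite (Order.le_val (z n)); apply: zt; exists n.
Qed.

Lemma nondecreasing_val (z : nat -> submonoid T) :
  Order.nondecreasing z -> Order.nondecreasing (val \o z).
Proof. by move=> znd m n /znd; rewrite -Order.le_val. Qed.

Lemma sup_sub_exists (z : nat -> submonoid T) : Order.nondecreasing z ->
  exists s : submonoid T, supremums (range (val \o z)) (val s).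
Proof.
move=> /nondecreasing_val znd; have [s zs] := Cu_O1 hS znd.
have sT : s \in T by apply: Tsup zs => // n; exact: valP.
by exists (exist _ s sT).
Qed.

(** A supremum computed in [T] is one in [S]: since [T] contains the supremum
    taken in [S], the two agree. *)
Lemma sup_sub_val (z : nat -> submonoid T) s : Order.nondecreasing z ->
  supremums (range z) s -> supremums (range (val \o z)) (val s).
Proof.
move=> znd zs; have [t zt] := sup_sub_exists znd.
by rewrite (sup_unique zs (sup_val_sub zt)).
Qed.

(** From left to right, [y] is the supremum in [T] of a sequence of [T] that is
    ≪-increasing in [S], so [x] is below a term that lies way below [y] in
    [S]. *)
Lemma way_below_val (x y : submonoid T) : x ≪ y <-> val x ≪ val y.
Proof.
split=> [xy|xy z znd s zs ys]; last first.
  have [n xn] := xy _ (nondecreasing_val znd) _ (sup_sub_val znd zs) ys.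
  by exists n; rewrite -Order.le_val.
have [z [zT zS zy]] := Tchain (valP y).
pose w n : submonoid T := exist _ (z n) (zT n).
have wnd : Order.nondecreasing w.
  by move=> m n mn; rewrite -Order.le_val; exact: way_below_chain.
have [n xn] := xy w wnd y (@sup_val_sub w y zy) (lexx y).
by apply: le_way_below (chain_way_below n zS zy); rewrite -Order.le_val in xn.
Qed.

Lemma sub_Cu_of_closed : sub_Cu_semigroup T.
Proof.
split; last first.
  split=> [|x y|z znd s|x y]; last by rewrite way_below_val.
  - by split=> [|x y]; [exact: Algebra.raddf0|exact: Algebra.raddfD].
  - by rewrite Order.le_val.
  - exact: sup_sub_val.
split=> [z znd|s|x' x y' y|x y xnd ynd s t xs yt].
- by have [s zs] := sup_sub_exists znd; exists s; exact: sup_val_sub.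
- have [z [zT zS zs]] := Tchain (valP s).
  exists (fun n => exist _ (z n) (zT n)); split=> [n|]; last exact: sup_val_sub.
  by apply/way_below_val; exact: zS.
- by rewrite !way_below_val !Algebra.raddfD; exact: Cu_O3.
apply: sup_val_sub; rewrite Algebra.raddfD.
rewrite (_ : val \o _ = fun n => val (x n) + val (y n)).
  by apply: (Cu_O4 hS); [exact: nondecreasing_val|exact: nondecreasing_val|
    exact: sup_sub_val|exact: sup_sub_val].
by apply/funext => n; exact: Algebra.raddfD.
Qed.

End SubCu.

(** Preservation of ≪ is part of being a Cu-morphism; reflection holds because
    the inclusion also preserves suprema and reflects the order. *)
Lemma sub_Cu_way_belowE (d : Order.disp_t) (S : poMonoidType d)
    (T : addrClosed S) (x y : submonoid T) :
  sub_Cu_semigroup T -> x ≪ y <-> val x ≪ val y.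
Proof.
move=> [_ [_ fle fsup fwb]]; split=> [|xy z znd s zs ys]; first exact: fwb.
have [||n xn] := xy _ _ _ (fsup z znd s zs).
- by move=> i j ij; apply: fle; exact: znd.
- exact: fle.
- by exists n; rewrite -Order.le_val.
Qed.

(** * Countable closure *)

Lemma countable_range (I : countType) (S : Type) (f : I -> S) :
  countable (range f).
Proof. exact: sub_countable (card_image_le _ _) (countableP _). Qed.

Lemma countable_setU (S : Type) (A B : set S) :
  countable A -> countable B -> countable (A `|` B).
Proof.
by move=> cA cB; rewrite -bigcup2E; apply: bigcup_countable => [|[|[|n]] _ /=].
Qed.

(** Downward Löwenheim-Skolem: the closure of [X] under countably many finitary
    operations consists of the values of the terms built from them. With the
    generators and the operations numbered, the terms are the trees
    [GenTree.tree nat], which form a countable type. *)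
Lemma countable_closure (S : choiceType) (x0 : S) (P : seq S -> set S -> Prop)
    (X : set S) :
  (forall s (A B : set S), A `<=` B -> P s A -> P s B) ->
  (forall s, exists2 C, countable C & P s C) -> countable X ->
  exists D : set S, [/\ X `<=` D, countable D &
    forall s, (forall x, x \in s -> D x) -> P s D].
Proof.
move=> Pmono Pex cX.
have enum (A : set S) : countable A -> exists e : nat -> S, A `<=` range e.
  move=> /countable_injP[f finj].
  have /choice[e eP] (i : nat) : exists x, forall y, A y -> f y = i -> x = y.
    have [[y [Ay fy]]|no] := pselect (exists y, A y /\ f y = i).
      by exists y => z Az fz; apply: finj; rewrite ?inE // fy.
    by exists x0 => y Ay fy; case: no; exists y.
  by exists e => y Ay; exists (f y) => //; exact: eP.
have [e eX] := enum X cX.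
(* [F s] enumerates witnesses for [P s]; the m-th operation is
   [fun s => F s m]. *)
have /choice[F FP] (s : seq S) : exists f : nat -> S, P s (range f).
  by have [C /enum[f Cf] PC] := Pex s; exists f; exact: Pmono PC.
pose ev := fix ev (t : GenTree.tree nat) := match t with
  | GenTree.Leaf i => e i
  | GenTree.Node m ts => F (map ev ts) m end.
exists (range ev); split.
- by move=> x /eX[i _ <-]; exists (GenTree.Leaf i).
- exact: sub_countable (card_image_le _ _) (countableP _).
move=> s sD; have [ts <-] : exists ts, map ev ts = s.
  elim: s sD => [|x s IHs] sD; first by exists [::].
  have [|ts <-] := IHs; first by move=> y ys; apply: sD; rewrite inE ys orbT.
  have [t _ <-] := sD x (mem_head _ _).
  by exists (t :: ts).
by apply: Pmono (FP _) => _ [m _ <-]; exists (GenTree.Node m ts).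
Qed.

(** * Transfer of the dimension *)

Section Main.
Context {d : Order.disp_t} {S : poMonoidType d}.
Hypothesis hS : Cu_semigroup S.
Implicit Types (D X : set S) (n : nat).

(** Because ≪ is taken in [S], this is a closure property of the set [D]: it
    can be forced by adding solutions, before any sub-Cu-semigroup is at
    hand. *)
Definition dim_le_within D n : Prop :=
  forall (r : nat) (x' x : S) (y : 'I_r -> S),
    D x' -> D x -> (forall j, D (y j)) -> x' ≪ x -> x ≪ \sum_(j < r) y j ->
  exists z : 'I_r -> 'I_n.+1 -> S, (forall j k, D (z j k)) /\
    [/\ forall j k, z j k ≪ y j,
        x' ≪ \sum_(j < r) \sum_(k < n.+1) z j k
      & forall k, \sum_(j < r) z j k ≪ x].

(** Countably many witnesses suffice for each finite tuple: one sum, the terms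
    of a sequence as in [Cu_O2], and a finite solution of the dimension
    condition. *)
Lemma countable_elementary_subset n X : dim_le S n -> countable X ->
  exists D, [/\ X `<=` D, countable D,
    D 0 /\ (forall a b, D a -> D b -> D (a + b)),
    D `<=` interpolated D & dim_le_within D n].
Proof.
move=> dimS cX.
pose Psum (s : seq S) (C : set S) := C (\sum_(x <- s) x).
pose Pint (s : seq S) (C : set S) := forall x t, s = x :: t -> interpolated C x.
(* The data [x', x, y_1, ..., y_r] are listed as one sequence. The equation for
   [r] spares casts when the [y_j] are given as a function on ['I_r]. *)
pose Pdim (s : seq S) (C : set S) := forall x' x (t : seq S) r,
  size t = r -> s = x' :: x :: t ->
  x' ≪ x -> x ≪ \sum_(j < r) nth 0 t j ->
  exists z : 'I_r -> 'I_n.+1 -> S, (forall j k, C (z j k)) /\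
    [/\ forall j k, z j k ≪ nth 0 t j,
        x' ≪ \sum_(j < r) \sum_(k < n.+1) z j k
      & forall k, \sum_(j < r) z j k ≪ x].
have intmono (A B : set S) x : A `<=` B ->
  interpolated A x -> interpolated B x.
  by move=> AB Ax u /Ax[e [/AB]]; exists e.
have summono s (A B : set S) : A `<=` B -> Psum s A -> Psum s B.
  by move=> AB /AB.
have intmono' s (A B : set S) : A `<=` B -> Pint s A -> Pint s B.
  by move=> AB As x t /As; exact: intmono.
have dimmono s (A B : set S) : A `<=` B -> Pdim s A -> Pdim s B.
  move=> AB As x' x t r tr st x'x xt.
  have [z [Az zP]] := As _ _ _ _ tr st x'x xt.
  by exists z; split=> // j k; exact: AB.
have intex s : exists2 C, countable C & Pint s C.
  case: s => [|x t]; first by exists set0.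
  have [z [zS zx]] := Cu_O2 hS x.
  exists (range z); first exact: countable_range.
  move=> _ _ [<- _] u ux; have [m um] := ux z (way_below_chain zS) x zx (lexx x).
  exists (z m.+1); split; [by exists m.+1|exact: le_way_below um (zS m)|].
  exact: chain_way_below zx.
have dimex s : exists2 C, countable C & Pdim s C.
  case: s => [|x' [|x t]]; [by exists set0|by exists set0|].
  have [[x'x xt]|no] := pselect (x' ≪ x /\ x ≪ \sum_(j < size t) nth 0 t j).
    have [z zP] := dimS _ _ _ _ x'x xt.
    exists (range (fun p => z p.1 p.2)); first exact: countable_range.
    move=> _ _ _ _ <- [<- <- <-] _ _; exists z; split=> // j k.
    by exists (j, k).
  by exists set0 => // _ _ _ _ <- [<- <- <-] x'x xt; case: no.
have [||D [XD cD DP]] := @countable_closure S 0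
    (fun s C => [/\ Psum s C, Pint s C & Pdim s C]) X _ _ cX.
- move=> s A B AB [A1 A2 A3].
  by split; [exact: summono A1|exact: intmono' A2|exact: dimmono A3].
- move=> s; have [C1 cC1 s1] := intex s; have [C2 cC2 s2] := dimex s.
  exists ([set \sum_(x <- s) x] `|` (C1 `|` C2)).
    by apply: countable_setU => //; exact: countable_setU.
  split; first by left.
  + by apply: intmono' s1 => x; right; left.
  + by apply: dimmono s2 => x; right; right.
exists D; split=> //.
- split=> [|a b Da Db].
    by have [|] := DP [::]; rewrite /Psum ?big_nil.
  have [|] := DP [:: a; b]; first by move=> x /[!inE] /orP[] /eqP->.
  by rewrite /Psum big_cons big_seq1.
- move=> x Dx; have [|_ + _] := DP [:: x]; last exact.
  by move=> y /[!inE] /eqP->.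
move=> r x' x y Dx' Dx Dy x'x xy.
have yE (j : 'I_r) : nth 0 (codom y) j = y j.
  by rewrite /codom /image_mem (nth_map j) ?size_enum_ord ?nth_ord_enum.
have [|_ _ /(_ x' x (codom y) r)] := DP (x' :: x :: codom y).
  by move=> u; rewrite !inE => /or3P[/eqP->|/eqP->|/codomP[j ->]].
rewrite size_codom card_ord (eq_bigr y) => [|j _]; last exact: yE.
move=> /(_ erefl erefl x'x xy)[z [Dz [z1 z2 z3]]].
by exists z; split=> //; split=> // j k; rewrite -yE.
Qed.

(** Closure under suprema and the approximating sequences required by
    [sub_Cu_of_closed] are [interpolated_sup] and [interpolated_chain]. *)
Lemma interpolated_sub_Cu D : D 0 -> (forall a b, D a -> D b -> D (a + b)) ->
  D `<=` interpolated D -> exists T : addrClosed S,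
    sub_Cu_semigroup T /\ forall s, s \in T <-> interpolated D s.
Proof.
move=> D0 DD Dint.
pose p : {pred S} := fun s => `[< interpolated D s >].
have pE s : s \in p <-> interpolated D s by split=> /asboolP.
have p_closed : Algebra.nmod_closed p.
  split=> [|x y]; rewrite !pE; first exact: interpolated0.
  exact: interpolatedD.
pose T : addrClosed S := HB.pack p (Algebra.isAddClosed.Build S p p_closed).
exists T; split=> //; apply: sub_Cu_of_closed => //.
- move=> z znd zT s zs; apply/pE; apply: interpolated_sup zs => // n.
  exact/pE/zT.
- move=> s /pE /(interpolated_chain hS)[e [De eS es]]; exists e; split=> // n.
  exact/pE/Dint.
Qed.

Section Generated.
Variables (D : set S) (T : addrClosed S).
Hypotheses (subT : sub_Cu_semigroup T) (Dint : D `<=` interpolated D).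
Hypothesis TE : forall s, s \in T <-> interpolated D s.

Let inT s (Ds : D s) : submonoid T := exist _ s ((TE s).2 (Dint Ds)).

Lemma interpolate_sub (x y : submonoid T) : x ≪ y ->
  exists e : submonoid T, [/\ D (val e), x ≪ e & e ≪ y].
Proof.
move=> /(sub_Cu_way_belowE _ _ subT) /((TE _).1 (valP y))[e [De xe ey]].
by exists (inT De); split=> //; exact/(sub_Cu_way_belowE _ _ subT).
Qed.

Lemma countably_based_sub : countable D -> countably_based (submonoid T).
Proof.
move=> /countable_injP[f finj]; exists [set x | D (val x)]; split.
  apply/countable_injP; exists (f \o val) => x y; rewrite !inE => Dx Dy fxy.
  by apply: val_inj; apply: finj; rewrite ?inE.
by move=> x y /interpolate_sub.
Qed.

(** The solution found in [D] lies between the given data because [x', x] were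
    moved inwards to [a' ≪ a] and the [y_j] down to [v_j]. *)
Lemma dim_le_sub n : dim_le_within D n -> dim_le (submonoid T) n.
Proof.
move=> Ddim r x' x y.
move=> /interpolate_sub[a' [Da' x'a' /interpolate_sub[a [Da a'a ax]]]].
move=> /(way_below_split_sum subT.1)[w [wy xw]].
have [v /all_and3[Dv wv vy]] := choice (fun j => interpolate_sub (wy j)).
have aw : val a ≪ \sum_(j < r) val (v j).
  rewrite -Algebra.raddf_sum -(sub_Cu_way_belowE _ _ subT).
  apply: way_below_trans ax _; apply: way_below_trans xw _.
  by apply: (way_below_sum subT.1).
have [z [Dz [zv a'z za]]] := Ddim r (val a') (val a) (fun j => val (v j)) Da' Da
  Dv ((sub_Cu_way_belowE _ _ subT).1 a'a) aw.
exists (fun j k => inT (Dz j k)); split.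
- move=> j k; apply: way_below_trans (vy j).
  exact/(sub_Cu_way_belowE _ _ subT)/zv.
- apply: way_below_trans x'a' _; apply/(sub_Cu_way_belowE _ _ subT).
  rewrite Algebra.raddf_sum; under eq_bigr do rewrite Algebra.raddf_sum.
  exact: a'z.
- move=> k; apply: way_below_trans ax; apply/(sub_Cu_way_belowE _ _ subT).
  by rewrite Algebra.raddf_sum; exact: za.
Qed.

End Generated.

Lemma dim_le_of_sub n :
  (forall X : set S, finite_set X -> exists T : addrClosed S,
     [/\ X `<=` [set` T], sub_Cu_semigroup T & dim_le (submonoid T) n]) ->
  dim_le S n.
Proof.
move=> subS r x' x y x'x xy.
have [|T [XT subT dimT]] := subS ([set x'; x] `|` range y).
  rewrite finite_setU; split; first exact: finite_set2.
  exact/finite_image/finite_finset.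
have x'T : x' \in T by apply: XT; left; left.
have xT : x \in T by apply: XT; left; right.
have yT j : y j \in T by apply: XT; right; exists j.
have wbE a b := sub_Cu_way_belowE a b subT.
have [||z [zy x'z zx]] := dimT r (exist _ x' x'T) (exist _ x xT)
  (fun j => exist _ (y j) (yT j)).
- exact/wbE.
- by apply/wbE; rewrite Algebra.raddf_sum.
exists (fun j k => val (z j k)); split.
- by move=> j k; exact: (wbE _ _).1 (zy j k).
- have := (wbE _ _).1 x'z; rewrite Algebra.raddf_sum.
  by under eq_bigr do rewrite Algebra.raddf_sum.
- by move=> k; have := (wbE _ _).1 (zx k); rewrite Algebra.raddf_sum.
Qed.

End Main.

Theorem theorem5p7 (d : Order.disp_t) (S : poMonoidType d) (hS : Cu_semigroup S) (n : nat) :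
  [<-> dim_le S n;
       forall X : set S, countable X ->
         exists T : addrClosed S,
           [/\ X `<=` [set` T], sub_Cu_semigroup T,
               countably_based (submonoid T) & dim_le (submonoid T) n];
       forall X : set S, finite_set X ->
         exists T : addrClosed S,
           [/\ X `<=` [set` T], sub_Cu_semigroup T & dim_le (submonoid T) n]].
Proof.
tfae.
- move=> dimS X cX.
  have [D [XD cD [D0 DD] Dint Ddim]] := countable_elementary_subset hS dimS cX.
  have [T [subT TE]] := interpolated_sub_Cu hS D0 DD Dint.
  exists T; split=> //.
  + by move=> x /XD /Dint /TE.
  + exact: countably_based_sub cD.
  + exact: dim_le_sub Ddim.
- move=> subS X /finite_set_countable /subS[T [XT subT _ dimT]].
  by exists T.
- exact: dim_le_of_sub.
Qed.
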